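(* Let $X$ be a periodic graph with period $L=\mathbb{Z}^N$, with vertex representatives $v_0,\dots,v_n$ ($n\ge1$) of $V/L$ and weights $w_{ij\gamma}$, let $\hat X$ be obtained from $X$ by contracting $v_0$ and $v_1$ to $\hat v$, and fix a period homomorphism $\rho\colon L\to\mathbb{R}^N$. Let $\Phi^{(h)}$ and $\hat\Phi^{(h)}$ be the harmonic realizations of $X$ and $\hat X$ with period homomorphism $\rho$, normalized by $\Phi^{(h)}(v_0)=\hat\Phi^{(h)}(\hat v)=0$. Let $\Phi^{(a)}$ be a periodic realization of $X$ with period homomorphism $\rho$ such that $\Phi^{(a)}(v_i)=\hat\Phi^{(h)}(v_i)$ for every $i\ne1$ (where for $i=0$ this means $\Phi^{(a)}(v_0)=\hat\Phi^{(h)}(\hat v)=0$) and such that $\Phi^{(a)}$ is harmonic around $v_1$. Then \[ \|\Phi^{(h)}(e_{010})\|\ \ge\ \|\Phi^{(a)}(e_{010})\| . \]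
   Context: A weighted graph $X=(V,E,w)$ has a vertex set $V$, a set $E$ of oriented edges, maps $o,t\colon E\to V$ (origin, terminal) and $\iota\colon E\to E$ (orientation reversal) with $\iota^2=\mathrm{id}$, $\iota(e)\ne e$, $o(\iota(e))=t(e)$, and a weight function $w\colon E\to\mathbb{R}_{\ge0}$ with $w\circ\iota=w$. Loops and multiple edges are allowed; parallel edges may be merged by adding their weights. $X$ is connected if the 1-complex formed by all vertices and the positive-weight edges is connected. A periodic graph is an infinite connected weighted graph with an action of $L=\mathbb{Z}^N$ ($N\ge1$) by weight-preserving automorphisms such that $X\to X/L$ is a covering and $X/L=(V/L,E/L)$ is finite. A periodic realization of $X$ is a map $\Phi\colon V\to\mathbb{R}^N$ together with an injective homomorphism $\rho\colon L\to\mathbb{R}^N$ (the period homomorphism) whose image is a lattice in $\mathbb{R}^N$, with $\Phi(\gamma v)=\Phi(v)+\rho(\gamma)$ for all $v\in V$, $\gamma\in L$. For an edge $e$, $\Phi(e):=\Phi(t(e))-\Phi(o(e))$, which descends to $E/L$. The energy is $\mathcal{E}(X,\Phi)=\frac12\sum_{e\in E/L}w(e)\|\Phi(e)\|^2$. $\Phi$ is harmonic if it minimizes $\mathcal{E}$ among periodic realizations with the same $\rho$; equivalently $\sum_{o(e)=v}w(e)\Phi(e)=0$ for all $v\in V$. $\Phi$ is harmonic around a vertex $v$ if this last equation holds at $v$. (A harmonic realization with given $\rho$ is unique up to translation.) Notation: $v_0,\dots,v_n\in V$ are representatives of $V/L$; $e_{ij\gamma}$ is the edge from $v_i$ to $\gamma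 v_j$ ($\gamma\in L$), of weight $w_{ij\gamma}\ge0$ (zero for all but finitely many $(i,j,\gamma)$; $w_{ij,-\gamma}=w_{ji\gamma}$); these edges represent $E/L$. Thus $e_{010}$ joins $v_0$ to $v_1$ (its weight may be zero). Contraction of $v_0$ and $v_1$ to $\hat v$: the periodic graph $\hat X$ with the same edges, weights and $L$-action, in which for every $\gamma\in L$ the vertices $\gamma v_0$ and $\gamma v_1$ are identified to a single vertex $\gamma\hat v$. *)

(* Defs.v *)
From Stdlib Require Export Relation_Operators.
From HB Require Import structures.
From mathcomp Require Export all_boot all_order all_algebra.
From mathcomp Require Export all_classical reals.

Set Implicit Arguments.
Unset Strict Implicit.
Unset Printing Implicit Defensive.

Import Order.TTheory GRing.Theory Num.Theory.
Local Open Scope classical_set_scope.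
Local Open Scope ring_scope.
Local Open Scope quotient_scope.

(* Euclidean norm; the norm [`|u|] of the libraries on row vectors is the sup
   norm. *)
Definition sqnorm (R : realType) (N : nat) (u : 'rV[R]_N) : R :=
  \sum_(i < N) u 0 i ^+ 2.
Definition enorm (R : realType) (N : nat) (u : 'rV[R]_N) : R :=
  Num.sqrt (sqnorm u).

(* A discrete subgroup of rank N: the integer span of a basis of R^N. *)
Definition is_lattice (R : realType) (N : nat) (A : set 'rV[R]_N) : Prop :=
  exists2 B : 'M[R]_N, B \in unitmx &
    A = range (fun z : 'rV[int]_N => map_mx intr z *m B).

Record Zaction (N : nat) (T : Type) := MkZaction {
  act_fun :> 'rV[int]_N -> T -> T;
  act0 : forall x, act_fun 0 x = x;
  actD : forall g h x, act_fun (g + h) x = act_fun g (act_fun h x)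
}.

Section Orbits.
Variables (N : nat) (T : choiceType) (a : Zaction N T).

Definition orbit_rel : rel T := fun x y => `[< exists g, y = a g x >].

Lemma orbit_rel_refl : reflexive orbit_rel.
Proof. by move=> x; apply/asboolP; exists 0; rewrite act0. Qed.

Lemma orbit_rel_sym : symmetric orbit_rel.
Proof.
suff imp x y : orbit_rel x y -> orbit_rel y x by move=> x y; apply/idP/idP; exact: imp.
by move=> /asboolP[g ->]; apply/asboolP; exists (- g); rewrite -actD addNr act0.
Qed.

Lemma orbit_rel_trans : transitive orbit_rel.
Proof.
move=> y x z /asboolP[g ->] /asboolP[h ->].
by apply/asboolP; exists (h + g); rewrite actD.
Qed.

Definition orbit_equiv : equiv_rel T :=
  EquivRel orbit_rel orbit_rel_refl orbit_rel_sym orbit_rel_trans.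

Definition orbit_space : Type := {eq_quot orbit_equiv}.

Definition orbit_pi (x : T) : orbit_space := \pi_({eq_quot orbit_equiv}) x.

Lemma orbit_piP x y : orbit_pi x = orbit_pi y <-> exists g, y = a g x.
Proof. by split=> [/eqmodP/asboolP|xy]; [|apply/eqmodP/asboolP]. Qed.

Lemma orbit_reprK (c : orbit_space) : orbit_pi (repr c) = c.
Proof. exact: reprK. Qed.

End Orbits.

Record weighted_graph (R : realType) := MkWeightedGraph {
  vert : choiceType;
  edge : choiceType;
  org : edge -> vert;
  ter : edge -> vert;
  rev : edge -> edge;
  wt : edge -> R;
  revK : forall e, rev (rev e) = e;
  rev_neq : forall e, rev e <> e;
  org_rev : forall e, org (rev e) = ter e;
  wt_ge0 : forall e, 0 <= wt e;
  wt_rev : forall e, wt (rev e) = wt e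
}.

Definition adjacent (R : realType) (X : weighted_graph R) (x y : vert X) : Prop :=
  exists e : edge X, [/\ 0 < wt e, org e = x & ter e = y].

(* Adjacency is symmetric, because [wt (rev e) = wt e]. *)
Definition connected_graph (R : realType) (X : weighted_graph R) : Prop :=
  forall x y : vert X, clos_refl_trans _ (@adjacent R X) x y.

Record lgraph (R : realType) (N : nat) := MkLGraph {
  lg_graph :> weighted_graph R;
  actv : Zaction N (vert lg_graph);
  acte : Zaction N (edge lg_graph);
  org_act : forall g e, org (acte g e) = actv g (org e);
  rev_act : forall g e, rev (acte g e) = acte g (rev e);
  wt_act : forall g e, wt (acte g e) = wt e
}.

Lemma ter_rev (R : realType) (X : weighted_graph R) (e : edge X) :
  ter (rev e) = org e.
Proof. by rewrite -org_rev revK. Qed.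

Lemma ter_act (R : realType) (N : nat) (X : lgraph R N) g (e : edge X) :
  ter (acte X g e) = actv X g (ter e).
Proof. by rewrite -!org_rev rev_act org_act. Qed.

(* [pg_cover] says that X -> X/L is a covering with deck group L: a free action
   on the vertices is also free on the edges and inverts no edge (lemmas
   [acte_free] and [acte_no_inversion]). *)
Record periodic_graph (R : realType) (N : nat) (X : lgraph R N) : Prop := {
  pg_dim : (0 < N)%N;
  pg_infinite : infinite_set [set: vert X];
  pg_connected : connected_graph X;
  pg_cover : forall g (x : vert X), actv X g x = x -> g = 0;
  pg_finv : finite_set [set: orbit_space (actv X)];
  pg_fine : finite_set [set: orbit_space (acte X)]
}.

Lemma acte_free (R : realType) (N : nat) (X : lgraph R N) :
  periodic_graph X -> forall g (e : edge X), acte X g e = e -> g = 0.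
Proof.
by move=> hX g e /(congr1 (@org _ _)); rewrite org_act; exact: pg_cover.
Qed.

Lemma acte_no_inversion (R : realType) (N : nat) (X : lgraph R N) :
  periodic_graph X -> forall g (e : edge X), acte X g e <> rev e.
Proof.
move=> hX g e ge.
have gg0 : g + g = 0.
  apply: (@acte_free _ _ X hX _ e).
  by rewrite actD ge -rev_act ge revK.
have g0 : g = 0.
  apply/rowP => i; move/rowP/(_ i): gg0; rewrite !mxE => /eqP.
  by rewrite -mulr2n mulrn_eq0 /= => /eqP.
by move: ge; rewrite g0 act0 => /esym; exact: rev_neq.
Qed.

Section Realizations.
Variables (R : realType) (N : nat) (X : lgraph R N).
Implicit Types (rho : {additive 'rV[int]_N -> 'rV[R]_N})
  (Phi : vert X -> 'rV[R]_N).

Definition period_hom rho : Prop := injective rho /\ is_lattice (range rho).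

Definition periodic_realization rho Phi : Prop :=
  period_hom rho /\ forall g x, Phi (actv X g x) = Phi x + rho g.

(* [disp Phi x y] is the value of Phi on any edge from x to y, including an
   edge of weight zero that is not listed in [edge X]. *)
Definition disp Phi (x y : vert X) : 'rV[R]_N := Phi y - Phi x.

Definition edge_disp Phi (e : edge X) : 'rV[R]_N := disp Phi (org e) (ter e).

Lemma edge_disp_act rho Phi g e : periodic_realization rho Phi ->
  edge_disp Phi (acte X g e) = edge_disp Phi e.
Proof.
move=> [_ hPhi]; rewrite /edge_disp /disp org_act ter_act !hPhi.
by rewrite opprD addrACA subrr addr0.
Qed.

(* The sum is over E/L; by [wt_act] and [edge_disp_act] the summand does not
   depend on the representative. *)
Definition energy Phi : R :=
  2^-1 * \sum_(c \in [set: orbit_space (acte X)])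
           (wt (repr c) * sqnorm (edge_disp Phi (repr c))).

Definition harmonic rho Phi : Prop :=
  periodic_realization rho Phi /\
  forall Psi, periodic_realization rho Psi -> energy Phi <= energy Psi.

(* In a periodic graph the index set is finite, since edges with the same
   origin lie in different orbits. *)
Definition harmonic_around Phi (x : vert X) : Prop :=
  \sum_(e \in [set e : edge X | org e = x]) (wt e *: edge_disp Phi e) = 0.

Definition representatives (n : nat) (v : 'I_n.+1 -> vert X) : Prop :=
  forall x : vert X, exists! i : 'I_n.+1, exists g, x = actv X g (v i).

End Realizations.

Section Contraction.
Variables (R : realType) (N : nat) (X : lgraph R N) (a b : vert X).

Definition contract_step (x y : vert X) : Prop :=
  exists g, x = actv X g a /\ y = actv X g b.

(* The equivalence relation generated by g a ~ g b, for all g in L. *)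
Definition contract_rel : rel (vert X) :=
  fun x y => `[< clos_refl_sym_trans _ contract_step x y >].

Lemma contract_rel_refl : reflexive contract_rel.
Proof. by move=> x; apply/asboolP; exact: rst_refl. Qed.

Lemma contract_rel_sym : symmetric contract_rel.
Proof.
suff imp x y : contract_rel x y -> contract_rel y x
  by move=> x y; apply/idP/idP; exact: imp.
by move=> /asboolP xy; apply/asboolP; exact: rst_sym.
Qed.

Lemma contract_rel_trans : transitive contract_rel.
Proof.
by move=> y x z /asboolP xy /asboolP yz; apply/asboolP; exact: rst_trans xy yz.
Qed.

Definition contract_equiv : equiv_rel (vert X) :=
  EquivRel contract_rel contract_rel_refl contract_rel_sym contract_rel_trans.

Definition contract_vert : Type := {eq_quot contract_equiv}.

Definition contract_pi (x : vert X) : contract_vert :=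
  \pi_({eq_quot contract_equiv}) x.

Lemma contract_piP x y :
  contract_pi x = contract_pi y <-> clos_refl_sym_trans _ contract_step x y.
Proof.
by split=> [/eqmodP/asboolP|xy]; [|apply/eqmodP/asboolP].
Qed.

Lemma contract_reprK (c : contract_vert) : contract_pi (repr c) = c.
Proof. exact: reprK. Qed.

Definition contract_actv_fun (g : 'rV[int]_N) (c : contract_vert) : contract_vert :=
  contract_pi (actv X g (repr c)).

Lemma contract_actvE g x :
  contract_actv_fun g (contract_pi x) = contract_pi (actv X g x).
Proof.
apply/contract_piP.
have /contract_piP : contract_pi (repr (contract_pi x)) = contract_pi x
  by exact: contract_reprK.
move: (repr _) => r; elim=> [y z [h [-> ->]]|y|y z _ IH|y z t _ IH1 _ IH2].
- by apply: rst_step; exists (g + h); rewrite !actD.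
- exact: rst_refl.
- exact: rst_sym.
- exact: rst_trans IH1 IH2.
Qed.

Lemma contract_act0 c : contract_actv_fun 0 c = c.
Proof. by rewrite /contract_actv_fun act0 contract_reprK. Qed.

Lemma contract_actD g h c :
  contract_actv_fun (g + h) c = contract_actv_fun g (contract_actv_fun h c).
Proof. by rewrite /(contract_actv_fun h) contract_actvE -actD. Qed.

Definition contract_actv : Zaction N contract_vert :=
  MkZaction contract_act0 contract_actD.

Definition contraction_graph : weighted_graph R :=
  @MkWeightedGraph R contract_vert (edge X)
    (fun e => contract_pi (org e)) (fun e => contract_pi (ter e))
    (@rev R X) (@wt R X) (@revK R X) (@rev_neq R X)
    (fun e => congr1 contract_pi (org_rev e)) (@wt_ge0 R X) (@wt_rev R X).

Lemma contraction_org_act g (e : edge contraction_graph) :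
  org (acte X g e : edge contraction_graph) = contract_actv g (org e).
Proof. by rewrite /= contract_actvE org_act. Qed.

Definition contraction : lgraph R N :=
  @MkLGraph R N contraction_graph contract_actv (acte X)
    contraction_org_act (@rev_act R N X) (@wt_act R N X).

Hypotheses (hX : periodic_graph X) (hab : forall g, actv X g a <> b).

Let collapse_spec x : exists y,
  (exists2 g, x = actv X g b & y = actv X g a) \/
  ((forall g, x <> actv X g b) /\ y = x).
Proof.
have [[g xg]|nx] := pselect (exists g, x = actv X g b).
  by exists (actv X g a); left; exists g.
by exists x; right; split=> // g xg; apply: nx; exists g.
Qed.

Let collapse x := projT1 (cid (collapse_spec x)).

Let act_inj g h x : actv X g x = actv X h x -> g = h.
Proof.
move=> gh; apply/eqP; rewrite -subr_eq0; apply/eqP.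
by apply: (pg_cover hX (x := x)); rewrite addrC actD gh -actD addNr act0.
Qed.

Let collapse_b g : collapse (actv X g b) = actv X g a.
Proof.
rewrite /collapse; case: cid => y /= [[h /act_inj -> //]|[/(_ g)]]; by [].
Qed.

Let collapse_nb x : (forall g, x <> actv X g b) -> collapse x = x.
Proof.
by rewrite /collapse; case: cid => y /= [[h xh _] /(_ h)|[_ ->]].
Qed.

Let nab g h : actv X g a <> actv X h b.
Proof.
move=> /(congr1 (actv X (- h))); rewrite -!actD addNr act0; exact: hab.
Qed.

Let collapse_pi x y : contract_pi x = contract_pi y -> collapse x = collapse y.
Proof.
move=> /contract_piP; elim=> [u z [g [-> ->]]|//|y' z _ -> //|y' z t _ -> _ -> //].
by rewrite collapse_b collapse_nb.
Qed.

Lemma contract_pi_eq x y : contract_pi x = contract_pi y <->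
  [\/ x = y, contract_step x y | contract_step y x].
Proof.
split=> [/collapse_pi|[->//|xy|yx]]; last 2 first.
- by apply/contract_piP; exact: rst_step.
- by apply/contract_piP; apply: rst_sym; exact: rst_step.
have [[g ->]|nx] := pselect (exists g, x = actv X g b);
  have [[h ->]|ny] := pselect (exists h, y = actv X h b).
- by rewrite !collapse_b => /act_inj ->; constructor 1.
- rewrite collapse_b collapse_nb => [<-|h yh]; last by apply: ny; exists h.
  by constructor 3; exists g.
- rewrite collapse_b collapse_nb => [->|g xg]; last by apply: nx; exists g.
  by constructor 2; exists h.
- rewrite !collapse_nb => [->|h yh|g xg]; first by constructor 1.
    by apply: ny; exists h.
  by apply: nx; exists g.
Qed.

Lemma contraction_free g (c : vert contraction) :
  actv contraction g c = c -> g = 0.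
Proof.
rewrite -[c]contract_reprK; move: (repr c) => x /=.
rewrite contract_actvE => /contract_pi_eq[|[h [e1 e2]]|[h [e1 e2]]].
- exact: pg_cover.
- by move: e1; rewrite e2 -actD => /esym /nab.
- by move: e2; rewrite e1 -actD => /nab.
Qed.

Lemma contraction_periodic : periodic_graph contraction.
Proof.
split.
- exact: pg_dim hX.
- have N0 := pg_dim hX.
  pose f (k : nat) : vert contraction :=
    actv contraction (const_mx k%:Z) (contract_pi a).
  have finj : injective f.
    move=> k l kl; have : const_mx k%:Z - const_mx l%:Z = 0 :> 'rV[int]_N.
      apply: (contraction_free (c := contract_pi a)).
      rewrite addrC actD -/(f k) kl /f -actD addNr act0 //.
    move=> /rowP/(_ (Ordinal N0)); rewrite !mxE => /eqP.
    by rewrite subr_eq0 => /eqP[].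
  move=> /(sub_finite_set (@subsetT _ (range f))).
  rewrite (eq_finite_set (B := [set: nat])); first exact: infinite_nat.
  by apply: inj_card_eq => x y _ _; exact: finj.
- move=> c d; rewrite -[c]contract_reprK -[d]contract_reprK.
  move: (repr c) (repr d) => x y.
  elim: (pg_connected hX x y) => [x' y' [e [we ex ey]]|x'|x' y' z _ IH1 _ IH2].
  + by apply: rt_step; exists e; split=> //=; rewrite ?ex ?ey.
  + exact: rt_refl.
  + exact: rt_trans IH1 IH2.
- exact: contraction_free.
- pose f (o : orbit_space (actv X)) : orbit_space (actv contraction) :=
    orbit_pi (actv contraction) (contract_pi (repr o)).
  apply: (sub_finite_set _ (finite_image f (pg_finv hX))) => o _.
  pose c : vert contraction := repr o.
  exists (orbit_pi (actv X) (repr (c : contract_vert))) => //.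
  rewrite -[RHS]orbit_reprK -/c; apply/orbit_piP.
  have /orbit_piP[g gE] := orbit_reprK (orbit_pi (actv X) (repr (c : contract_vert))).
  by exists g; rewrite /= contract_actvE -gE contract_reprK.
- exact: pg_fine hX.
Qed.

End Contraction.

(* Main.v *)
(* Work one coordinate at a time, with the Dirichlet form D on L-invariant
   functions.  Let delta be the indicator of the orbit of v_1, c and d the
   coordinates of Phi^(a)(v_1) and Phi^(h)(v_1), and g = Phi^(h) - Phi^(a).
   Harmonicity gives D(Phi^(h), f) = 0 for every invariant f, while
   Phi^(a) = hat Phi^(h) + c delta with D(hat Phi^(h), f) = 0 as soon as
   f(v_0) = f(v_1), and D(Phi^(a), delta) = 0.  Applying this to
   f = g - (d - c) delta yields
     D(g, g) = - D(Phi^(a), f) = c (d - c) D(delta, delta).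
   The left side is nonnegative and D(delta, delta) > 0 by connectedness, so
   c^2 <= c d, hence |c| <= |d|. *)

Require Import Defs.
From mathcomp Require Import ring lra.

Set Implicit Arguments.
Unset Strict Implicit.
Import Order.TTheory GRing.Theory Num.Theory.
Local Open Scope ring_scope.

(** * Sums over edge orbits and the Dirichlet form *)

Section OrbitSums.
Variables (R : realType) (N : nat) (X : lgraph R N).
Implicit Types (q : edge X -> R) (F G H f : vert X -> R) (e : edge X)
  (a x : vert X).

Definition edge_invariant q := forall g e, q (acte X g e) = q e.
Definition vert_invariant f := forall g x, f (actv X g x) = f x.

(** For an [edge_invariant] summand the choice of representatives is immaterial. *)
Definition orbit_sum q : R :=
  \sum_(c \in [set: orbit_space (acte X)]%classic) q (repr c).

Definition grad F e : R := F (ter e) - F (org e).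

Definition dirichlet F G : R :=
  orbit_sum (fun e => wt e * grad F e * grad G e).

Definition orbit_ind a x : R := (orbit_rel (actv X) a x)%:R.

Lemma orbit_ind_invariant a : vert_invariant (orbit_ind a).
Proof.
move=> g x; rewrite /orbit_ind; congr (_%:R); congr nat_of_bool.
have gx : orbit_rel (actv X) x (actv X g x) by apply/asboolP; exists g.
by apply/idP/idP => h; apply: orbit_rel_trans h _; rewrite // orbit_rel_sym.
Qed.

Lemma orbit_ind_id a : orbit_ind a a = 1.
Proof. by rewrite /orbit_ind orbit_rel_refl. Qed.

Lemma orbit_ind_out a x : (forall g, x <> actv X g a) -> orbit_ind a x = 0.
Proof. by move=> xa; rewrite /orbit_ind /orbit_rel asboolF // => -[g /xa]. Qed.

Lemma edge_invariant_repr q e : edge_invariant q ->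
  q (repr (orbit_pi (acte X) e)) = q e.
Proof.
move=> qI; have /orbit_piP[g gE] := orbit_reprK (orbit_pi (acte X) e).
by rewrite [in RHS]gE qI.
Qed.

(** Reversal commutes with the action, hence descends to an involution of E/L. *)
Lemma orbit_sum_rev q : edge_invariant q ->
  orbit_sum (fun e => q (rev e)) = orbit_sum q.
Proof.
move=> qI.
pose h (c : orbit_space (acte X)) := orbit_pi (acte X) (rev (repr c)).
have hK : involutive h.
  move=> c; rewrite -[RHS]orbit_reprK /h; apply/orbit_piP.
  have /orbit_piP[g gE] := orbit_reprK (orbit_pi (acte X) (rev (repr c))).
  by exists g; rewrite -rev_act -gE revK.
rewrite /orbit_sum [RHS](reindex_fsbigT h); last by exact: inv_bij.
by apply: eq_fsbigr => c _; rewrite edge_invariant_repr.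
Qed.

Hypothesis finE : finite_set [set: orbit_space (acte X)].

Lemma orbit_sum_seqE q : orbit_sum q =
  \sum_(c <- finmap.enum_fset (fset_set [set: orbit_space (acte X)]%classic))
    q (repr c).
Proof. exact: fsbig_finite. Qed.

Lemma dirichletC F G : dirichlet F G = dirichlet G F.
Proof. by apply: eq_fsbigr => c _; rewrite mulrAC. Qed.

Lemma dirichlet_linearl F G t H :
  dirichlet (fun x => F x + t * G x) H = dirichlet F H + t * dirichlet G H.
Proof.
rewrite /dirichlet !orbit_sum_seqE mulr_sumr -big_split /=.
by apply: eq_bigr => c _; rewrite /grad; ring.
Qed.

Lemma dirichlet_linearr F G t H :
  dirichlet H (fun x => F x + t * G x) = dirichlet H F + t * dirichlet H G.
Proof. by rewrite !(dirichletC H) dirichlet_linearl. Qed.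

Lemma dirichlet_ge0 F : 0 <= dirichlet F F.
Proof.
rewrite /dirichlet orbit_sum_seqE; apply: sumr_ge0 => c _.
by rewrite -mulrA mulr_ge0 ?wt_ge0 // -expr2 sqr_ge0.
Qed.

(** * First variation of the energy *)

Lemma energyE (Phi : vert X -> 'rV[R]_N) :
  energy Phi =
  2^-1 * \sum_i dirichlet (fun x => Phi x 0 i) (fun x => Phi x 0 i).
Proof.
rewrite /energy fsbig_finite //; congr (_ * _).
under [RHS]eq_bigr do rewrite /dirichlet orbit_sum_seqE.
rewrite exchange_big /=; apply: eq_bigr => c _; rewrite /sqnorm mulr_sumr.
by apply: eq_bigr => i _; rewrite /edge_disp /disp /grad !mxE -mulrA expr2.
Qed.

Lemma energy_variation (Phi : vert X -> 'rV[R]_N) f i t :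
  energy (fun x => Phi x + (t * f x) *: delta_mx 0 i) =
  energy Phi + t * dirichlet (fun x => Phi x 0 i) f
             + 2^-1 * t ^+ 2 * dirichlet f f.
Proof.
rewrite !energyE (bigD1 i) //= [in RHS](bigD1 i) //=.
set A := \sum_(_ | _) _; set B := \sum_(_ | _) _.
have -> : A = B.
  apply: eq_bigr => j ji; apply: eq_fsbigr => c _.
  by rewrite /grad !mxE eqxx /= (negPf ji) !mulr0 !addr0.
have -> : (fun x => (Phi x + (t * f x) *: delta_mx 0 i) 0 i) =
          (fun x => Phi x 0 i + t * f x).
  by apply: funext => x; rewrite !mxE !eqxx mulr1.
rewrite dirichlet_linearl !dirichlet_linearr.
rewrite (dirichletC f (fun x => Phi x 0 i)).
by field.
Qed.

(** Invariance of [f] keeps the perturbed map among the competitors for [rho]; a quadratic in [t]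
    that is nonnegative and vanishes at 0 has no linear term. *)
Lemma harmonic_dirichlet (rho : {additive 'rV[int]_N -> 'rV[R]_N}) Phi f i :
  harmonic rho Phi -> vert_invariant f -> dirichlet (fun x => Phi x 0 i) f = 0.
Proof.
move=> [[hrho PhiI] Phimin] fI.
set B := dirichlet _ _; pose C := dirichlet f f.
have C0 : 0 <= C := dirichlet_ge0 f.
have min t : 0 <= t * B + 2^-1 * t ^+ 2 * C.
  have := Phimin (fun x => Phi x + (t * f x) *: delta_mx 0 i).
  rewrite energy_variation -addrA lerDl; apply; split=> // g x.
  by rewrite PhiI fI addrAC.
have C1 : 0 < C + 1 by rewrite ltr_wpDl.
apply/eqP; rewrite -sqrf_eq0; apply/eqP/le_anti; rewrite sqr_ge0 andbT.
(* Dividing by [C + 1] rather than by [C], which would give the minimum, also covers [C = 0]. *)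
have := min (- (B / (C + 1))).
have -> : - (B / (C + 1)) * B + 2^-1 * (- (B / (C + 1))) ^+ 2 * C =
          - (B ^+ 2 * ((C + 2) / (2 * (C + 1) ^+ 2))).
  by field; rewrite gt_eqF.
rewrite oppr_ge0 pmulr_lle0 // divr_gt0 //; last first.
  by rewrite mulr_gt0 // exprn_gt0.
by rewrite ltr_wpDl.
Qed.

(** * Stars of vertices, summation by parts, connectedness *)

Hypothesis hX : periodic_graph X.

(* An edge orbit contains at most one edge with origin [a], by freeness. *)
Lemma orbit_pi_star_inj a :
  {in [set e | org e = a]%classic &, injective (orbit_pi (acte X))}.
Proof.
move=> e e'; rewrite !inE /= => ea e'a /orbit_piP[g gE].
suff g0 : g = 0 by rewrite gE g0 act0.
by apply: (pg_cover hX (x := a)); rewrite -{2}e'a gE org_act ea.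
Qed.

(** Makes sums over a star genuine: a set-indexed sum with infinitely many nonzero terms defaults to
    0. *)
Lemma finite_star a : finite_set [set e : edge X | org e = a]%classic.
Proof.
rewrite -(eq_finite_set (inj_card_eq (@orbit_pi_star_inj a))).
exact: sub_finite_set (@subsetT _ _) (pg_fine hX).
Qed.

(** [orbit_pi] maps the star of [a] bijectively onto the edge orbits whose origins lie in the orbit
    of [a]: it is injective by freeness, and any representative of such an orbit can be translated
    to start at [a]. *)
Lemma star_sumE q a : edge_invariant q ->
  \sum_(e \in [set e | org e = a]%classic) q e =
  orbit_sum (fun e => q e * orbit_ind a (org e)).
Proof.
move=> qI; pose S := [set c : orbit_space (acte X) |
  orbit_rel (actv X) a (org (repr c))]%classic.
rewrite /orbit_sum -(fsbig_widen S) //; last first.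
  by move=> c [_ /= /negP/negPf nS]; rewrite /orbit_ind nS mulr0.
rewrite (reindex_fsbig (orbit_pi (acte X)) [set e | org e = a]%classic).
  apply: eq_fsbigr => e; rewrite inE /= => ea.
  rewrite (@edge_invariant_repr (fun e => q e * orbit_ind a (org e))).
    by rewrite ea orbit_ind_id mulr1.
  by move=> g e'; rewrite qI org_act orbit_ind_invariant.
split; last 1 first.
- move=> c /= /asboolP[g ca]; exists (acte X (- g) (repr c)).
    by rewrite /= org_act ca -actD addNr act0.
  rewrite -[RHS]orbit_reprK; apply/orbit_piP; exists g.
  by rewrite -actD subrr act0.
- move=> e; rewrite /S /= => ea.
  have /esym/orbit_piP[g ->] := orbit_reprK (orbit_pi (acte X) e).
  by apply/asboolP; exists g; rewrite org_act ea.
- exact: orbit_pi_star_inj.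
Qed.

(** Coordinates of a realization change by constants under periods; it is their gradients that are
    invariant. *)
Definition quasi_periodic F := edge_invariant (grad F).

Lemma vert_invariant_quasi_periodic f : vert_invariant f -> quasi_periodic f.
Proof. by move=> fI g e; rewrite /grad ter_act org_act !fI. Qed.

(** Summation by parts: [grad F] is odd under reversal, so the terminal and origin contributions of
    the indicator are equal, whence the factor 2. *)
Lemma dirichlet_orbit_ind F a : quasi_periodic F ->
  dirichlet F (orbit_ind a) =
  - 2 * \sum_(e \in [set e | org e = a]%classic) (wt e * grad F e).
Proof.
move=> FI; pose q e := wt e * grad F e.
have qI : edge_invariant q by move=> g e; rewrite /q wt_act FI.
rewrite (star_sumE a qI).
pose r e := q e * orbit_ind a (org e).
have rI : edge_invariant r.
  by move=> g e; rewrite /r qI org_act orbit_ind_invariant.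
have -> : - 2 * orbit_sum r = - orbit_sum (fun e => r (rev e)) - orbit_sum r.
  by rewrite orbit_sum_rev //; ring.
rewrite /dirichlet !orbit_sum_seqE -!sumrN -big_split /=.
apply: eq_bigr => c _; rewrite /r /q wt_rev org_rev /grad org_rev ter_rev; ring.
Qed.

(** All terms are nonnegative, so [f] is constant along every edge of positive weight; connectedness
    does the rest. *)
Lemma dirichlet_eq0 f : vert_invariant f -> dirichlet f f = 0 ->
  forall x y, f x = f y.
Proof.
move=> fI D0.
pose q e := wt e * grad f e * grad f e.
have qI : edge_invariant q.
  by move=> g e; rewrite /q wt_act vert_invariant_quasi_periodic.
have q0 e : q e = 0.
  rewrite -(edge_invariant_repr _ qI).
  apply: (pfsumr_eq0 (pg_fine hX) _ D0) => // c _.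
  by rewrite -mulrA mulr_ge0 ?wt_ge0 // -expr2 sqr_ge0.
move=> x y; elim: (pg_connected hX x y) => //
  [{}x {}y [e [we <- <-]]|? ? ? _ -> //].
apply/esym/eqP; move/eqP: (q0 e).
by rewrite /q /grad -mulrA !mulf_eq0 gt_eqF //= orbb subr_eq0.
Qed.

End OrbitSums.

(** * Contraction, local harmonicity and positivity *)

Arguments dirichlet {R N X}.
Arguments orbit_ind {R N X}.

(** Such an [f] is constant on contracted classes and descends to the contraction, where harmonicity
    applies. Edges and their orbits are unchanged, so the two Dirichlet forms agree by
    conversion. *)
Lemma contraction_dirichlet (R : realType) (N : nat) (X : lgraph R N)
    (a b : vert X) (rho : {additive 'rV[int]_N -> 'rV[R]_N})
    (Psi : vert (contraction a b) -> 'rV[R]_N) (f : vert X -> R) i :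
  finite_set [set: orbit_space (acte X)]%classic ->
  harmonic rho Psi -> vert_invariant f -> f a = f b ->
  dirichlet (fun x => Psi (contract_pi a b x) 0 i) f = 0.
Proof.
move=> finE hPsi fI fab.
have fpi x y : contract_pi a b x = contract_pi a b y -> f x = f y.
  move=> /contract_piP; elim=> [{}x {}y [g [-> ->]]|//|//|? ? ? _ -> _ -> //].
  by rewrite !fI.
pose hf (c : vert (contraction a b)) : R := f (repr (c : contract_vert a b)).
have hfE x : hf (contract_pi a b x) = f x by apply: fpi; exact: contract_reprK.
have hfI : vert_invariant hf.
  by move=> g c; rewrite -[c]contract_reprK /= contract_actvE !hfE fI.
rewrite -(_ : (fun x => hf (contract_pi a b x)) = f); last exact: funext.
exact: (@harmonic_dirichlet _ _ (contraction a b) finE _ _ _ i hPsi hfI).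
Qed.

Lemma representatives_inj (R : realType) (N n : nat) (X : lgraph R N)
    (v : 'I_n.+1 -> vert X) i j g :
  representatives v -> v i = actv X g (v j) -> i = j.
Proof.
move=> hv ij; have [k [_ kU]] := hv (v i).
by rewrite -(kU i) -1?(kU j) //; [exists g | exists 0; rewrite act0].
Qed.

Lemma periodic_realization_grad (R : realType) (N : nat) (X : lgraph R N)
    (rho : {additive 'rV[int]_N -> 'rV[R]_N}) (Phi : vert X -> 'rV[R]_N) i :
  periodic_realization rho Phi -> quasi_periodic (fun x => Phi x 0 i).
Proof.
move=> hPhi g e; have := edge_disp_act g e hPhi.
by move=> /rowP/(_ i); rewrite !mxE.
Qed.

Lemma harmonic_around_dirichlet (R : realType) (N : nat) (X : lgraph R N)
    (rho : {additive 'rV[int]_N -> 'rV[R]_N}) (Phi : vert X -> 'rV[R]_N) a i :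
  periodic_graph X -> periodic_realization rho Phi -> harmonic_around Phi a ->
  dirichlet (fun x => Phi x 0 i) (orbit_ind a) = 0.
Proof.
move=> hX hPhi; rewrite /harmonic_around.
have finE := pg_fine hX.
rewrite (dirichlet_orbit_ind finE hX); last first.
  exact: periodic_realization_grad hPhi.
(* The vector sum and the coordinate sum may have different supports, so both are expanded over the
   whole star. *)
rewrite !(fsbig_finite _ _ (finite_star hX a)) => /rowP/(_ i).
rewrite summxE mxE => h.
apply/eqP; rewrite mulf_eq0; apply/orP; right; apply/eqP.
rewrite -[RHS]h; apply: eq_bigr => e _.
by rewrite /grad !mxE.
Qed.

(** Otherwise the indicator would be constant, yet it is 1 at [a] and 0 at [b]. *)
Lemma dirichlet_orbit_ind_gt0 (R : realType) (N : nat) (X : lgraph R N)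
    (a b : vert X) :
  periodic_graph X -> (forall g, b <> actv X g a) ->
  0 < dirichlet (orbit_ind a) (orbit_ind a).
Proof.
move=> hX ab; rewrite lt0r (dirichlet_ge0 (pg_fine hX)) andbT; apply/eqP => D0.
have := dirichlet_eq0 hX (orbit_ind_invariant a) D0 a b.
by rewrite orbit_ind_id orbit_ind_out // => /eqP; rewrite oner_eq0.
Qed.

Theorem theorem7p6 (R : realType) (N n : nat) (hn : (1 <= n)%N)
  (X : lgraph R N) (hX : periodic_graph X)
  (v : 'I_n.+1 -> vert X) (hv : representatives v)
  (rho : {additive 'rV[int]_N -> 'rV[R]_N}) (hrho : period_hom rho)
  (Phih : vert X -> 'rV[R]_N)
  (hPhih : harmonic rho Phih) (hPhih0 : Phih (v ord0) = 0)
  (hatPhih : vert (contraction (v ord0) (v (inord 1))) -> 'rV[R]_N)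
  (hhatPhih : harmonic rho hatPhih)
  (hhatPhih0 : hatPhih (contract_pi (v ord0) (v (inord 1)) (v ord0)) = 0)
  (Phia : vert X -> 'rV[R]_N)
  (hPhia : periodic_realization rho Phia)
  (hPhia_eq : forall i : 'I_n.+1, i <> inord 1 ->
     Phia (v i) = hatPhih (contract_pi (v ord0) (v (inord 1)) (v i)))
  (hPhia1 : harmonic_around Phia (v (inord 1))) :
  enorm (disp Phih (v ord0) (v (inord 1)))
    >= enorm (disp Phia (v ord0) (v (inord 1))).
Proof.
set v0 := v ord0; set v1 := v (inord 1).
(* By [hn], [inord 1] has value 1 and not the default 0. *)
have v10 g : v0 <> actv X g v1.
  move=> /(representatives_inj hv)/(congr1 val) /=.
  by rewrite inordK // ltnS.
have finE := pg_fine hX.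
pose Psi x := hatPhih (contract_pi v0 v1 x).
have PsiI g x : Psi (actv X g x) = Psi x + rho g.
  by case: hhatPhih => -[_ PI] _; rewrite /Psi -contract_actvE -PI.
have Psi1 : Psi v1 = 0.
  rewrite /Psi -hhatPhih0; congr hatPhih; apply/esym/contract_piP.
  by apply: rst_step; exists 0; rewrite !act0.
(* Both sides shift by [rho g], so representatives suffice; at [v1] the term [Psi] vanishes. *)
have PhiaE x : Phia x = Psi x + orbit_ind v1 x *: Phia v1.
  have [j [[g xg] _]] := hv x; rewrite xg hPhia.2 PsiI orbit_ind_invariant.
  have [->|/eqP j1] := eqVneq j (inord 1).
    by rewrite -/v1 orbit_ind_id scale1r Psi1 add0r addrC.
  rewrite hPhia_eq // -/v0 -/v1 -/(Psi (v j)) orbit_ind_out ?scale0r ?addr0 //.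
  by move=> h /(representatives_inj hv).
have Phia0 : Phia v0 = 0.
  by rewrite hPhia_eq // => /(congr1 val) /=; rewrite inordK // ltnS.
rewrite /disp Phia0 hPhih0 !subr0 /enorm ler_wsqrtr // ler_sum // => i _.
set c := Phia v1 0 i; set d := Phih v1 0 i.
(* Indeed [d ^+ 2 - c ^+ 2 = 2 * c * (d - c) + (d - c) ^+ 2]. *)
suff : 0 <= c * (d - c) by nra.
pose delta := orbit_ind v1; pose K := dirichlet delta delta.
have K0 : 0 < K by exact: dirichlet_orbit_ind_gt0 v10.
pose A x := Phia x 0 i; pose H x := Phih x 0 i; pose P x := Psi x 0 i.
pose g x := H x + (- 1) * A x.
have gI : vert_invariant g.
  by move=> h x; rewrite /g /A /H hPhia.2 hPhih.1.2 !mxE; ring.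
have dI : vert_invariant delta := orbit_ind_invariant v1.
have Hf f : vert_invariant f -> dirichlet H f = 0.
  exact: harmonic_dirichlet hPhih.
have Ad : dirichlet A delta = 0.
  exact: harmonic_around_dirichlet hPhia hPhia1.
have AE : A = (fun x => P x + c * delta x).
  by apply: funext => x; rewrite /A PhiaE !mxE mulrC.
have Pf f : vert_invariant f -> f v0 = f v1 -> dirichlet P f = 0.
  by move=> fI f01; exact: (contraction_dirichlet i finE hhatPhih fI f01).
have dg : dirichlet delta g = 0.
  by rewrite dirichletC dirichlet_linearl // Hf // Ad mulr0 addr0.
(* [g] is 0 at [v0] and [d - c] at [v1]; the correction equalizes these values, so that [f] is
   orthogonal to [P]. *)
pose f x := g x + (- (d - c)) * delta x.
have fI : vert_invariant f by move=> h x; rewrite /f gI dI.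
have f01 : f v0 = f v1.
  rewrite /f /g /A /H Phia0 hPhih0 /delta orbit_ind_id orbit_ind_out //.
  by rewrite -/c -/d !mxE; ring.
have gg : dirichlet g g = c * (d - c) * K.
  rewrite {1}/g dirichlet_linearl // Hf // add0r.
  have -> : g = (fun x => f x + (d - c) * delta x).
    by apply: funext => x; rewrite /f; ring.
  rewrite dirichlet_linearr // Ad mulr0 addr0.
  (* Only [c * dirichlet delta f] survives, and by [dg] it equals [- c * (d - c) * K]. *)
  rewrite AE dirichlet_linearl // Pf // add0r /f dirichlet_linearr // dg -/K.
  ring.
by rewrite -(pmulr_lge0 _ K0) -gg; exact: dirichlet_ge0.
Qed.
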